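(* For $n>1$ and $k>5$ odd, let $NC(2nk+1,k)$ be the number of non-isomorphic cyclic $(K_{2nk+1},C_k)$-designs. Then there is an integer $N$ such that for all $n\ge N$ and all odd $k>5$: - if $n\not\equiv 4\pmod 7$, then $NC(2nk+1,k)\ge \dfrac{(2.49)^n}{k}$; - if $n\equiv 4\pmod 7$, then $NC(2nk+1,k)\ge \dfrac{(3.35)^n}{k}$.
   Context: A $(K_v,C_k)$-design (or $k$-cycle system of the complete graph $K_v$) is a set $\mathcal{B}$ of $k$-cycles of $K_v$ whose edges partition the edge-set of $K_v$. It is cyclic if the vertex-set can be identified with $\mathbb{Z}_v$ in such a way that $B=(b_1,\dots,b_k)\in\mathcal{B}$ implies $B+z=(b_1+z,\dots,b_k+z)\in\mathcal{B}$ for all $z\in\mathbb{Z}_v$. Two $(K_v,C_k)$-designs with cycle sets $\mathcal{B}$ and $\mathcal{B}'$ are isomorphic if there is a permutation of the vertex-set turning $\mathcal{B}$ into $\mathcal{B}'$. $NC(v,k)$ is the number of cyclic $(K_v,C_k)$-designs up to isomorphism. *)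

(* Defs.v *)
From mathcomp Require Import all_boot all_order all_fingroup all_algebra.

Set Implicit Arguments.
Unset Strict Implicit.
Unset Printing Implicit Defensive.

Import GRing.Theory.

Local Open Scope nat_scope.

Definition complete_edges (T : finType) : {set {set T}} :=
  [set e : {set T} | #|e| == 2].

(* A cycle (b_1, ..., b_k) is identified with its edge-set, so that the       *)
(* rotations and reflections of a vertex sequence give the same cycle.        *)
Definition cycle_edges (T : finType) (b : seq T) : {set {set T}} :=
  [set [set x; next b x] | x in b].

Definition is_kcycle (T : finType) (k : nat) (C : {set {set T}}) : bool :=
  (2 < k) && [exists b : k.-tuple T, uniq b && (C == cycle_edges b)].

(* As cycles are edge-sets, the edges of the cycles of B partition the        *)
(* edge-set of the complete graph exactly when B is a partition of it.        *)
Definition is_design (T : finType) (k : nat) (B : {set {set {set T}}})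
  : bool :=
  [forall C in B, is_kcycle k C] && partition B (complete_edges T).

Definition map_cycle (T T' : finType) (f : T -> T') (C : {set {set T}})
  : {set {set T'}} := [set [set f x | x in e] | e : {set T} in C].

Definition map_cycles (T T' : finType) (f : T -> T')
  (B : {set {set {set T}}}) : {set {set {set T'}}} :=
  [set map_cycle f C | C in B].

Definition isomorphic (T : finType) (B B' : {set {set {set T}}}) : bool :=
  [exists s : {perm T}, map_cycles s B == B'].

(* From here on K_v has vertex-set Z_v; the type has v elements only if 1 < v *)
Definition translation_closed (v : nat) (B : {set {set {set 'Z_v}}}) : bool :=
  [forall C in B, forall z : 'Z_v, map_cycle (fun x => x + z)%R C \in B].

(* The permutation s is the identification of the vertex-set with Z_v.        *)
Definition is_cyclic (v : nat) (B : {set {set {set 'Z_v}}}) : bool :=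
  [exists s : {perm 'Z_v}, translation_closed (map_cycles s B)].

Definition cyclic_designs (v k : nat) : {set {set {set {set 'Z_v}}}} :=
  [set B | is_design k B && is_cyclic B].

Definition NC (v k : nat) : nat :=
  #|equivalence_partition (@isomorphic 'Z_v) (cyclic_designs v k)|.

(* Main.v *)
(* If s is an isomorphism from a cyclic design B to a cyclic design, both      *)
(* invariant under the translation t, then s is determined by s 0 and by the   *)
(* automorphism s^-1 o t o s of B.  Counting pairs gives at most v invariant   *)
(* designs isomorphic to B, so T invariant designs yield NC(v,k) >= T / v.     *)
(*                                                                             *)
(* Invariant designs come from n base cycles whose differences are 1, ..., nk  *)
(* up to sign.  A base cycle has one small difference e <= n, one pair of      *)
(* differences (w, w + d) with d odd close to e, and pairs (x, x + 2) cut out  *)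
(* of blocks of four consecutive integers, plus at most one pair (x, x + 1);   *)
(* it alternates between low vertices, which move by +-2 within each of two    *)
(* parity classes, and far away vertices, so it is simple.  As the blocks of   *)
(* four may be permuted among the base cycles with e odd, this gives at least  *)
(* ceil(n/2)! designs, which outgrows every c^n, in particular 4^n.            *)

Require Import Defs.
From mathcomp Require Import all_boot all_order all_fingroup all_algebra.
From mathcomp Require Import zify.

Set Implicit Arguments.
Unset Strict Implicit.
Unset Printing Implicit Defensive.

Import Order.TTheory GRing.Theory Num.Theory.

(** * Isomorphism classes of cyclic designs *)

(** The bound is obtained by producing many translation-invariant designs on Z_v, v = 2nk+1, and
    dividing by the largest possible number of them in one isomorphism class. By
    [card_isomorphic_translation_closed] that number is at most v, which gives [card_le_NC].

    Designs come from n base cycles whose edges realise all differences 1, ..., nk up to sign. The n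
    base cycles have nk edges in all, so coverage forces each difference to occur exactly once;
    hence the translates partition the edges ([edge_inj], [development_is_design]). Moreover, a
    difference determines the base cycle containing it. Suppose a family depends on a permutation s
    so that base cycle i always contains a key difference K i, together with X (s i). Then the
    design determines s, and [factorial_le_NC] yields o! designs.

    Such families are built from [zigzag] cycles, in [family3_difference_family] for k = 3 mod 4 and
    [family1_difference_family] for k = 1 mod 4, with o = ceil(n/2). Thus o! <= NC * v <= NC * 3nk.
    For n >= 576, o! is at least 3n * 4^n ([exp4_le_uphalf_fact]), so NC >= 4^n / k, and 4 exceeds
    both 2.49 and 3.35. *)

Lemma map_cycle_comp (T1 T2 T3 : finType) (f : T1 -> T2) (g : T2 -> T3)
    (C : {set {set T1}}) :
  map_cycle (g \o f) C = map_cycle g (map_cycle f C).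
Proof.
rewrite /map_cycle -imset_comp; apply: eq_imset => e /=.
by rewrite -imset_comp.
Qed.

Lemma map_cycles_comp (T1 T2 T3 : finType) (f : T1 -> T2) (g : T2 -> T3)
    (B : {set {set {set T1}}}) :
  map_cycles (g \o f) B = map_cycles g (map_cycles f B).
Proof.
rewrite /map_cycles -imset_comp; apply: eq_imset => C /=.
exact: map_cycle_comp.
Qed.

Lemma eq_map_cycle (T T' : finType) (f g : T -> T') :
  f =1 g -> @map_cycle T T' f =1 map_cycle g.
Proof. by move=> fg C; apply: eq_imset => e; apply: eq_imset. Qed.

Lemma eq_map_cycles (T T' : finType) (f g : T -> T') :
  f =1 g -> @map_cycles T T' f =1 map_cycles g.
Proof. by move=> fg B; apply: eq_imset => C; apply: eq_map_cycle. Qed.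

Lemma map_cycle_id (T : finType) (f : T -> T) : f =1 id -> map_cycle f =1 id.
Proof.
move=> fid C; rewrite /map_cycle -[RHS]imset_id; apply: eq_imset => e.
by rewrite -[RHS]imset_id; apply: eq_imset.
Qed.

Lemma map_cycles_id (T : finType) (f : T -> T) : f =1 id -> map_cycles f =1 id.
Proof.
move=> fid B; rewrite /map_cycles -[RHS]imset_id; apply: eq_imset => C.
exact: map_cycle_id.
Qed.

Lemma map_cycles_inj (T T' : finType) (f : T -> T') :
  injective f -> injective (@map_cycles T T' f).
Proof. by move=> injf; do 3!apply: imset_inj. Qed.

Lemma card_map_cycles (T T' : finType) (f : T -> T') (B : {set {set {set T}}}) :
  injective f -> #|map_cycles f B| = #|B|.
Proof. by move=> injf; apply: card_imset; do 2!apply: imset_inj. Qed.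

Lemma map_cyclesM (T : finType) (s t : {perm T}) (B : {set {set {set T}}}) :
  map_cycles (s * t)%g B = map_cycles t (map_cycles s B).
Proof. by rewrite -map_cycles_comp; apply: eq_map_cycles => x; rewrite permM. Qed.

Lemma map_cyclesV (T : finType) (s : {perm T}) (B : {set {set {set T}}}) :
  map_cycles (s^-1)%g (map_cycles s B) = B.
Proof. by rewrite -map_cyclesM map_cycles_id // => x; rewrite mulgV perm1. Qed.

Lemma isomorphic_refl (T : finType) (B : {set {set {set T}}}) : isomorphic B B.
Proof.
by apply/existsP; exists 1%g; rewrite map_cycles_id // => x; rewrite perm1.
Qed.

Section IsomorphismClasses.

Variable v : nat.
Implicit Types B : {set {set {set 'Z_v}}}.

Definition shift : {perm 'Z_v} := perm (@addIr _ (1 : 'Z_v)%R).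

Lemma shiftXE i x : ((shift ^+ i)%g x = x + i%:R)%R.
Proof.
elim: i => [|i IH] in x *; first by rewrite expg0 perm1 addr0.
by rewrite expgSr permM IH permE -addrA -mulrSr.
Qed.

Lemma translation_closed_shift B :
  translation_closed B -> map_cycles shift B = B.
Proof.
move=> /forall_inP tB; apply/eqP; rewrite eqEcard card_map_cycles ?leqnn; last first.
  exact: perm_inj.
rewrite andbT; apply/subsetP => _ /imsetP[C CB ->].
have /forallP/(_ 1%R) := tB C CB.
by rewrite (@eq_map_cycle _ _ shift (fun x => x + 1)%R) // => x; rewrite permE.
Qed.

(** Double counting: a pair of an invariant B' isomorphic to B and an automorphism of B gives an
    isomorphism s from B to B'. Then s is recovered from the automorphism obtained by conjugating
    the translation by s, and from s 0. So the pairs number at most v times the order of the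
    automorphism group, and that order cancels. *)
Lemma card_isomorphic_translation_closed B :
  #|[set B' | translation_closed B' & isomorphic B B']| <= #|{: 'Z_v}|.
Proof.
set I := [set _ | _ & _].
pose A := [set a : {perm 'Z_v} | map_cycles a B == B].
have A_gt0 : 0 < #|A|.
  apply/card_gt0P; exists 1%g; rewrite inE map_cycles_id // => x.
  by rewrite perm1.
pose iso B' := odflt 1%g [pick s : {perm 'Z_v} | map_cycles s B == B'].
have isoP B' : B' \in I -> map_cycles (iso B') B = B'.
  rewrite inE /iso => /andP[_ /existsP[s sB]].
  by case: pickP => [t /eqP //|/(_ s)]; rewrite sB.
pose f (x : {set {set {set 'Z_v}}} * {perm 'Z_v}) : {perm 'Z_v} := (x.2 * iso x.1)%g.
have fB x : x \in setX I A -> map_cycles (f x) B = x.1.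
  case: x => B' a /setXP[IB']; rewrite inE => /eqP aB.
  by rewrite map_cyclesM aB isoP.
pose g x := ((f x * shift * (f x)^-1)%g, f x 0%R).
have gA : g @: setX I A \subset setX A [set: 'Z_v].
  apply/subsetP => _ /imsetP[x xIA ->]; rewrite !inE andbT 2!map_cyclesM fB //.
  rewrite translation_closed_shift; first by rewrite -{1}(fB x xIA) map_cyclesV.
  by move: xIA; rewrite inE => /andP[]; rewrite inE => /andP[].
(* The conjugated translation moves 0 through the preimages of s 0, s 0 + 1, ..., so it determines s
   once s 0 is known. *)
have f_iter x i : f x (((f x * shift * (f x)^-1) ^+ i)%g 0%R) = (f x 0 + i%:R)%R.
  move: (f x) => s.
  have -> : (s * shift * s^-1 = shift ^ s^-1)%g.
    by rewrite conjgE invgK mulgA.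
  by rewrite -conjXg conjgE invgK !permM permKV shiftXE.
have g_inj : {in setX I A &, injective g}.
  move=> x y xIA yIA [eq1 eq2].
  have eqf : f x = f y.
    apply/permP => z.
    pose i := (f x z - f x 0)%R.
    have zE : ((f x * shift * (f x)^-1) ^+ i)%g 0%R = z.
      apply: (@perm_inj _ (f x)); rewrite f_iter natr_Zp /i.
      by rewrite addrC subrK.
    by rewrite -zE {2}eq1 !f_iter eq2.
  have eqB : x.1 = y.1 by rewrite -(fB x) // -(fB y) // eqf.
  move: eqf eqB; rewrite /f.
  by case: x y {xIA yIA eq1 eq2} => B1 a [B2 b] /= + eqB; rewrite eqB => /mulIg->.
rewrite -(leq_pmul2r A_gt0) -cardsX -(card_in_imset g_inj).
by apply: leq_trans (subset_leq_card gA) _; rewrite cardsX cardsT mulnC.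
Qed.

Lemma card_le_NC k (F : {set {set {set {set 'Z_v}}}}) : 1 < v ->
  {in F, forall B, is_design k B && translation_closed B} ->
  #|F| <= NC v k * v.
Proof.
move=> v_gt1 FP.
have cardT : #|{: 'Z_v}| = v by rewrite card_ord Zp_cast.
rewrite -[leqRHS]/(NC v k * _) -[X in _ * X]cardT.
have subF : F \subset cyclic_designs v k.
  apply/subsetP => B /FP/andP[dB tB]; rewrite inE dB /=; apply/existsP; exists 1%g.
  by rewrite map_cycles_id // => x; rewrite perm1.
rewrite /NC /equivalence_partition; set cl := fun x => [set y in _ | _].
pose P := cl @: F.
(* Split F by isomorphism class; each fibre has at most v members. *)
have -> : #|F| = \sum_(c in P) #|[set B in F | cl B == c]|.
  rewrite -sum1_card (partition_big cl (mem P)) /=; last by move=> B; apply: imset_f.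
  by apply: eq_bigr => c _; rewrite -sum1_card; apply: eq_bigl => B; rewrite inE.
apply: (@leq_trans (\sum_(c in P) #|{: 'Z_v}|)); last first.
  by rewrite sum_nat_const leq_mul2r subset_leq_card ?orbT // imsetS.
apply: leq_sum => _ /imsetP[B BF ->].
apply: leq_trans (card_isomorphic_translation_closed B).
apply: subset_leq_card; apply/subsetP => B'; rewrite !inE => /andP[BF' /eqP eqcl].
case/andP: (FP _ BF') => _ -> /=.
have : B' \in cl B' by rewrite inE isomorphic_refl (subsetP subF).
by rewrite eqcl inE => /andP[].
Qed.

End IsomorphismClasses.

(** * Development of a difference family *)

Lemma cycle_edges_mkseq (T : finType) (f : nat -> T) (k : nat) :
  {in gtn k &, injective f} ->
  cycle_edges (mkseq f k) = [set [set f u; f (u.+1 %% k)] | u : 'I_k].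
Proof.
move=> injf.
have uf : uniq (mkseq f k) by apply/mkseq_uniqP.
have nextf (u : 'I_k) : next (mkseq f k) (f u) = f (u.+1 %% k).
  have fu : f u \in mkseq f k by apply: map_f; rewrite mem_iota /=.
  have idx : index (f u) (mkseq f k) = u.
    by rewrite -{1}(nth_mkseq (f u) f (ltn_ord u)) index_uniq ?size_mkseq.
  rewrite next_nth fu idx.
  case: k u {injf uf fu idx} => [[]//|k] u.
  rewrite /mkseq /=.
  have := ltn_ord u; rewrite leq_eqVlt ltnS => /orP[/eqP[->]|ltuk].
    by rewrite modnn nth_default // size_map size_iota.
  by rewrite modn_small // (nth_map 0) ?size_iota // nth_iota.
apply/setP => e; apply/imsetP/imsetP => [[x /mapP[u]]|[u _ ->]].
  rewrite mem_iota add0n /= => ltuk -> ->.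
  by exists (Ordinal ltuk) => //; rewrite -(nextf (Ordinal ltuk)).
by exists (f u); rewrite ?nextf // map_f // mem_iota /=.
Qed.

Definition has_difference (v k : nat) (c : nat -> nat) (d : nat) : Prop :=
  exists2 u, u < k &
    c u + d = c (u.+1 %% k) %[mod v] \/ c (u.+1 %% k) + d = c u %[mod v].

(** Only coverage is required in [df_cover]; that no difference repeats follows by counting in
    [edge_inj]. *)
Record difference_family (n k : nat) (S : nat -> nat -> nat) : Prop := {
  df_lt : forall r u, r < n -> u < k -> S r u < 2 * n * k + 1;
  df_inj : forall r, r < n -> {in gtn k &, injective (S r)};
  df_cover : forall d, 0 < d <= n * k ->
    exists2 r, r < n & has_difference (2 * n * k + 1) k (S r) d
}.

Lemma natr_Zp_eq (v a b : nat) : 1 < v ->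
  (a%:R = b%:R :> 'Z_v)%R <-> a = b %[mod v].
Proof.
move=> v_gt1; split => [/(congr1 val)|eq_ab] /=; first by rewrite !val_Zp_nat.
by apply: val_inj; rewrite /= !val_Zp_nat.
Qed.

Section Development.

Variables (n k : nat) (S : nat -> nat -> nat).
Hypotheses (n_gt0 : 0 < n) (k_gt2 : 2 < k) (dfS : difference_family n k S).

Notation v := (2 * n * k + 1).
Notation T := 'Z_v.

Let v_gt1 : 1 < v.
Proof. by rewrite addn1 ltnS !muln_gt0 n_gt0 (ltnW (ltnW k_gt2)). Qed.

Let card_T : #|{: T}| = v.
Proof. by rewrite card_ord Zp_cast. Qed.

Let k_gt0 : 0 < k. Proof. exact: ltnW (ltnW k_gt2). Qed.

Definition vertex (r : nat) (z : T) (u : nat) : T := ((S r u)%:R + z)%R.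

Definition starter_cycle (rz : 'I_n * T) : {set {set T}} :=
  cycle_edges (mkseq (vertex rz.1 rz.2) k).

Definition development : {set {set {set T}}} := [set starter_cycle rz | rz : 'I_n * T].

Let edge (x : ('I_n * T) * 'I_k) : {set T} :=
  [set vertex x.1.1 x.1.2 x.2; vertex x.1.1 x.1.2 (x.2.+1 %% k)].

Lemma vertex_inj r z : r < n -> {in gtn k &, injective (vertex r z)}.
Proof.
move=> ltrn u u' ltu ltu' /addIr /natr_Zp_eq -/(_ v_gt1).
by rewrite !modn_small ?(df_lt dfS) //; apply: (df_inj dfS).
Qed.

Lemma starter_cycleE rz : starter_cycle rz = [set edge (rz, u) | u : 'I_k].
Proof. by rewrite /starter_cycle cycle_edges_mkseq //; apply: vertex_inj. Qed.

Lemma next_neq (u : 'I_k) : u.+1 %% k != u.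
Proof.
have := ltn_ord u; rewrite leq_eqVlt => /orP[/eqP eq_k|lt_k].
  by rewrite eq_k modnn; apply: contraTneq k_gt2 => u0; rewrite -eq_k -u0.
by rewrite modn_small // neq_ltn ltnSn orbT.
Qed.

Lemma edge_complete x : edge x \in complete_edges T.
Proof.
rewrite inE cards2 (contraNneq _ (next_neq x.2)) // => eq_v.
rewrite eq_sym; apply/eqP; apply: (vertex_inj (ltn_ord x.1.1) _ _ eq_v).
  by rewrite inE /= ltn_ord.
by rewrite inE /= ltn_pmod.
Qed.

Lemma edge_difference (a c : T) (d : nat) : 0 < d <= n * k ->
  (a - c = d%:R)%R -> exists x, edge x = [set a; c].
Proof.
move=> d_bd ac.
have [r ltrn [u ltuk]] := df_cover dfS d_bd.
case=> /(natr_Zp_eq _ _ v_gt1); rewrite natrD => eqS.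
  exists (Ordinal ltrn, (c - (S r u)%:R)%R, Ordinal ltuk).
  by rewrite /edge /vertex /= -eqS addrAC subrKC -ac subrKC setUC.
exists (Ordinal ltrn, (a - (S r u)%:R)%R, Ordinal ltuk).
by rewrite /edge /vertex /= subrKC -eqS opprD addrCA addNKr -ac opprB subrKC.
Qed.

Lemma edge_surj e : e \in complete_edges T -> exists x, edge x = e.
Proof.
rewrite inE => /cards2P[a [c [neq_ac ->]]].
have d_gt0 (b b' : T) : b != b' -> 0 < val (b - b')%R.
  move=> neq; rewrite lt0n; apply: contraNneq neq => eq0.
  by rewrite -subr_eq0; apply/eqP/val_inj.
have [d_le|d_gt] := leqP (val (a - c)%R) (n * k).
  by apply: (@edge_difference a c (val (a - c)%R)); rewrite ?natr_Zp // d_gt0.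
(* Since v = 2nk+1, one of a - c and c - a has its representative at most nk. *)
rewrite setUC; apply: (@edge_difference c a (val (c - a)%R)); last by rewrite natr_Zp.
rewrite d_gt0 1?eq_sym // -(opprB a c).
move: (a - c)%R (d_gt0 a c neq_ac) d_gt => d dp d_gt.
rewrite /= in dp d_gt *; move: (nat_of_ord d) dp d_gt => m dp d_gt.
by rewrite Zp_cast // modn_small; lia.
Qed.

(* The edges are exactly as many as the triples (base cycle, shift, index).    *)
Lemma edge_inj : injective edge.
Proof.
have /imset_injP injT : #|edge @: [set: 'I_n * T * 'I_k]| == #|[set: 'I_n * T * 'I_k]|.
  have -> : edge @: [set: _] = complete_edges T.
    apply/setP => e; apply/imsetP/idP => [[x _ ->]|/edge_surj[x <-]].
      exact: edge_complete.
    by exists x.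
  rewrite card_draws card_T bin2 cardsT !card_prod card_T !card_ord.
  by rewrite addn1 /= mulnC -!mulnA mul2n doubleK; apply/eqP; lia.
by move=> x y; apply: injT; rewrite inE.
Qed.

Lemma development_is_design : is_design k development.
Proof.
apply/andP; split.
  apply/forall_inP => _ /imsetP[rz _ ->]; rewrite /is_kcycle k_gt2 /=.
  have sz : size (mkseq (vertex rz.1 rz.2) k) == k by rewrite size_mkseq.
  apply/existsP; exists (Tuple sz); rewrite eqxx andbT.
  by apply/mkseq_uniqP; apply: vertex_inj.
apply/and3P; split.
- apply/eqP/setP => e; apply/bigcupP/idP => [[_ /imsetP[rz _ ->]]|].
    by rewrite starter_cycleE => /imsetP[u _ ->]; apply: edge_complete.
  case/edge_surj=> [[rz u] <-]; exists (starter_cycle rz); first exact: imset_f.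
  by rewrite starter_cycleE; apply/imsetP; exists u.
- apply/trivIsetP => _ _ /imsetP[rz _ ->] /imsetP[rz' _ ->]; apply: contraNT.
  case/pred0Pn => e /=; rewrite !starter_cycleE => /andP[/imsetP[u _ ->] /imsetP[u' _]].
  by move/edge_inj=> [-> _].
- apply/imsetP => [[rz _ eq0]].
  have : edge (rz, Ordinal k_gt0) \in starter_cycle rz.
    by rewrite starter_cycleE; apply/imsetP; exists (Ordinal k_gt0).
  by rewrite -eq0 inE.
Qed.

Lemma development_translation_closed : translation_closed development.
Proof.
apply/forall_inP => _ /imsetP[[r z] _ ->]; apply/forallP => t.
apply/imsetP; exists (r, z + t)%R => //.
rewrite !starter_cycleE /map_cycle -imset_comp; apply: eq_imset => u /=.
by rewrite /edge imsetU1 imset_set1 /vertex !addrA.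
Qed.

(** Translating either occurrence of d gives the edge {0, d}, which belongs to a single base cycle
    by [edge_inj]. *)
Lemma has_difference_row r r' d : 0 < d <= n * k -> r < n -> r' < n ->
  has_difference v k (S r) d -> has_difference v k (S r') d -> r = r'.
Proof.
move=> d_bd.
suff edgeE q : q < n -> has_difference v k (S q) d ->
    exists rz u, edge (rz, u) = [set 0; d%:R]%R /\ rz.1 = q :> nat.
  move=> ltr ltr' /(edgeE _ ltr)[rz [u [e1 <-]]] /(edgeE _ ltr')[rz' [u' [e2 <-]]].
  by move: e1; rewrite -e2 => /edge_inj[-> _].
move=> ltq [u ltu].
case=> /(natr_Zp_eq _ _ v_gt1); rewrite natrD => eqS.
  exists (Ordinal ltq, - (S q u)%:R)%R, (Ordinal ltu); split=> //.
  by rewrite /edge /vertex /= -eqS subrr addrC addKr.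
exists (Ordinal ltq, - (S q (u.+1 %% k))%:R)%R, (Ordinal ltu); split=> //.
by rewrite /edge /vertex /= -eqS subrr addrC addKr setUC.
Qed.

(** This makes the differences of a base cycle a property of its edge-set, so they can be compared
    when one cycle occurs in the developments of two families. *)
Lemma starter_cycle_difference (rz : 'I_n * T) d : 0 < d <= n * k ->
  has_difference v k (S rz.1) d <->
  exists a c : T, [set a; c] \in starter_cycle rz /\ (a - c = d%:R)%R.
Proof.
move=> /andP[d_gt0 d_le]; rewrite starter_cycleE.
have d_neq0 : (d%:R != 0 :> T)%R.
  apply/eqP => /(congr1 val); rewrite /= val_Zp_nat // modn_small => [d0|].
    by rewrite d0 in d_gt0.
  by rewrite addn1 ltnS (leq_trans d_le) // leq_mul2r leq_pmull ?orbT.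
split=> [[u ltu]|[a [c [/imsetP[u _ eq_e] ac]]]].
  case=> /(natr_Zp_eq _ _ v_gt1); rewrite natrD => eqS.
    exists (vertex rz.1 rz.2 (u.+1 %% k)), (vertex rz.1 rz.2 u).
    split; last by rewrite /vertex -eqS [X in (_ - X)%R]addrC addrKA addrC addKr.
    by rewrite setUC; apply/imsetP; exists (Ordinal ltu).
  exists (vertex rz.1 rz.2 u), (vertex rz.1 rz.2 (u.+1 %% k)).
  split; last by rewrite /vertex -eqS [X in (_ - X)%R]addrC addrKA addrC addKr.
  by apply/imsetP; exists (Ordinal ltu).
have neq_ac : a != c by rewrite -subr_eq0 ac.
exists u => //.
have : a \in edge (rz, u) by rewrite -eq_e set21.
have : c \in edge (rz, u) by rewrite -eq_e set22.
rewrite !inE /= => /orP[] /eqP ec /orP[] /eqP ea; move: neq_ac ac; rewrite ea ec ?eqxx //.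
  move=> _ /eqP; rewrite /vertex [X in (_ - X)%R]addrC addrKA subr_eq addrC -natrD.
  by move=> /eqP/(natr_Zp_eq _ _ v_gt1) ->; left; rewrite addnC.
move=> _ /eqP; rewrite /vertex [X in (_ - X)%R]addrC addrKA subr_eq addrC -natrD.
by move=> /eqP/(natr_Zp_eq _ _ v_gt1) ->; right; rewrite addnC.
Qed.
End Development.

Lemma factorial_le_NC (n k o : nat) (S : {perm 'I_o} -> nat -> nat -> nat)
    (K X : nat -> nat) :
  0 < n -> 2 < k -> o <= n ->
  (forall s, difference_family n k (S s)) ->
  (forall i, i < o -> 0 < K i <= n * k) ->
  (forall i, i < o -> 0 < X i <= n * k) ->
  (forall s (i : 'I_o), has_difference (2 * n * k + 1) k (S s i) (K i)) ->
  (forall s (i : 'I_o), has_difference (2 * n * k + 1) k (S s i) (X (s i))) ->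
  o`! <= NC (2 * n * k + 1) k * (2 * n * k + 1).
Proof.
move=> n_gt0 k_gt2 le_on dfS K_bd X_bd SK SX.
have lt_n (i : 'I_o) : i < n := leq_trans (ltn_ord i) le_on.
pose D s := @development n k (S s).
have D_inj : injective D.
  move=> s t eqD; apply/permP => i.
  have : starter_cycle (S s) (Ordinal (lt_n i), 0%R) \in D t by rewrite -eqD; apply: imset_f.
  case/imsetP=> rz _ eq_cycle.
  have transfer d : 0 < d <= n * k -> has_difference (2 * n * k + 1) k (S s i) d ->
      has_difference (2 * n * k + 1) k (S t rz.1) d.
    have cycle_diff u := starter_cycle_difference n_gt0 k_gt2 (dfS u).
    move=> d_bd /(cycle_diff s (Ordinal (lt_n i), 0%R) _ d_bd).
    by rewrite eq_cycle => /(cycle_diff t _ _ d_bd).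
  have row (j : 'I_o) d : 0 < d <= n * k -> has_difference (2 * n * k + 1) k (S s i) d ->
      has_difference (2 * n * k + 1) k (S t j) d -> rz.1 = j :> nat.
    move=> d_bd /(transfer _ d_bd).
    exact: (has_difference_row n_gt0 k_gt2 (dfS t) d_bd (ltn_ord _) (lt_n j)).
  (* The key difference K i places the cycle in row i of the family of t; the difference X (s i)
     places it in row t^-1 (s i). *)
  have eq_i : rz.1 = i :> nat by apply: row (SK s i) (SK t i); apply: K_bd.
  have eq_j : rz.1 = (t^-1)%g (s i) :> nat.
    apply: row (SX s i) _; first exact: X_bd.
    by rewrite -{2}[s i](permKV t); apply: SX.
  by apply/esym; apply: (canLR (permKV t)); apply: val_inj; rewrite /= -eq_i -eq_j.
rewrite -card_Sn -(card_imset _ D_inj).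
apply: leq_trans (card_le_NC (F := D @: [set: _]) _ _).
- by apply/subset_leq_card/subsetP => _ /imsetP[s _ ->]; apply: imset_f.
- by rewrite addn1 ltnS !muln_gt0 n_gt0 (ltnW (ltnW k_gt2)).
- move=> _ /imsetP[s _ ->].
  by rewrite development_is_design // development_translation_closed.
Qed.

(** * Zigzag cycles *)

(** The closing edge is excluded and the difference is taken in the natural numbers, so that
    explicit cycles can be treated by linear arithmetic. *)
Definition has_gap (k : nat) (c : nat -> nat) (d : nat) : Prop :=
  exists2 u, u.+1 < k & c u + d = c u.+1 \/ c u.+1 + d = c u.

Lemma has_gap_difference v k c d : has_gap k c d -> has_difference v k c d.
Proof. by case=> u ltu [] gap; exists u; rewrite ?(modn_small ltu) ?gap; auto; lia. Qed.

Lemma has_gap_complement v k c d :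
  d <= v -> has_gap k c (v - d) -> has_difference v k c d.
Proof.
move=> le_dv [u ltu gap]; exists u; rewrite ?(modn_small ltu); first exact: ltnW.
case: gap => <-; [right|left]; rewrite -addnA subnK //; exact: modnDr.
Qed.

Lemma closing_difference v k c d :
  c 0 + d = c k \/ c k + d = c 0 -> has_difference v k.+1 c d.
Proof. by move=> [] gap; exists k; rewrite // modnn gap; auto. Qed.

Definition prepend (f g : nat) (c : nat -> nat) (u : nat) : nat :=
  match u with 0 => f | 1 => g | u'.+2 => c u' end.

Lemma has_gap_prepend k f g c d : has_gap k c d -> has_gap k.+2 (prepend f g c) d.
Proof. by case=> u ltu gap; exists u.+2. Qed.

Lemma prepend_gap k f g c d : 0 < k -> c 0 + d = g \/ g + d = c 0 ->
  has_gap k.+2 (prepend f g c) d.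
Proof. by move=> k_gt0 gap; exists 1 => //=; lia. Qed.

Lemma prepend_gap0 k f g c d : f + d = g \/ g + d = f ->
  has_gap k.+2 (prepend f g c) d.
Proof. by move=> gap; exists 0. Qed.

Lemma prepend_inj k f g c : f <> g ->
  (forall u, u < k -> c u <> f) -> (forall u, u < k -> c u <> g) ->
  {in gtn k &, injective c} -> {in gtn k.+2 &, injective (prepend f g c)}.
Proof.
move=> fg cf cg injc [|[|u]] [|[|u']] //; rewrite !inE /= => ltu ltu' eqc.
- by case: (cf u').
- by case: (fg).
- by case: (cg u').
- by case: (cf u).
- by case: (cg u).
- by rewrite (injc u u').
Qed.

Ltac split_ifs := repeat (case: ifP => ?).

(* The zigzag starts at the low vertex M, and M is so large that no            *)
(* subtraction below is truncated.  Its low vertices move by -2 through the    *)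
(* pairs of differences (a t, a t + 2), by -d through (w, w + d), by +2        *)
(* through (b t, b t + 2), and a single edge closes the cycle.                 *)
Section Zigzag.

Variables (M p q d w : nat) (a b : nat -> nat).

Definition low t :=
  if t <= p then M - 2 * t else M - (2 * p + d) + 2 * (t - p.+1).

Definition up t :=
  if t < p then M + a t - 2 * t
  else if t == p then M - (2 * p + d + w)
  else low t + b (t - p.+1) + 2.

Definition zigzag u := if odd u then up u./2 else low u./2.

Definition zigzag_length := (2 * (p + q).+1).+1.

(** All conditions are written additively to avoid truncated subtraction. [zz_a_gt] and [zz_b_gt]
    put the corresponding upper vertices above M, [zz_a_le] and [zz_b_le] keep them at most 2M. The
    last three fields keep them distinct: a t - 2t increases, b t + 2t decreases, and the two
    families do not meet. *)
Record zigzag_spec : Prop := ZigzagSpec {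
  zz_M_ge : 2 * p + d + w <= M;
  zz_d_odd : odd d;
  zz_w_gt0 : 0 < w;
  zz_q_le : 2 * q <= 2 * p + d;
  zz_a_gt : forall t, t < p -> 2 * t < a t;
  zz_b_gt : forall t, t < q -> 2 * p + d < b t + 2 * t + 2;
  zz_a_le : forall t, t < p -> a t <= M;
  zz_b_le : forall t, t < q -> b t + 2 * t + 2 <= M + 2 * p + d;
  zz_a_lt : forall t t', t < t' -> t' < p -> a t + 2 * t' < a t' + 2 * t;
  zz_b_lt : forall t t', t < t' -> t' < q -> b t' + 2 * t' < b t + 2 * t;
  zz_ab_neq : forall t t', t < p -> t' < q ->
    a t + 2 * p + d <> b t' + 2 * t + 2 * t' + 2
}.

Hypothesis zzP : zigzag_spec.

Let M_ge := zz_M_ge zzP.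
Let d_odd := zz_d_odd zzP.
Let w_gt0 := zz_w_gt0 zzP.
Let q_le := zz_q_le zzP.
Let a_gt := zz_a_gt zzP.
Let b_gt := zz_b_gt zzP.

Lemma zigzag_gap_below t x : t <= p + q ->
  up t + x = low t \/ low t + x = up t -> has_gap zigzag_length zigzag x.
Proof.
move=> let_pq gap; exists (2 * t); first by rewrite /zigzag_length; lia.
by rewrite /zigzag /= oddM /= mul2n doubleK uphalf_double; lia.
Qed.

Lemma zigzag_gap_above t x : t <= p + q ->
  up t + x = low t.+1 \/ low t.+1 + x = up t -> has_gap zigzag_length zigzag x.
Proof.
move=> let_pq gap; exists (2 * t).+1; first by rewrite /zigzag_length; lia.
by rewrite /zigzag /= oddM /= mul2n doubleK uphalf_double; lia.
Qed.

Lemma zigzag_gap_a t : t < p -> has_gap zigzag_length zigzag (a t).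
Proof. by move=> lt_tp; apply: (@zigzag_gap_below t); rewrite /up /low; split_ifs; lia. Qed.

Lemma zigzag_gap_a2 t : t < p -> has_gap zigzag_length zigzag (a t + 2).
Proof. by move=> lt_tp; apply: (@zigzag_gap_above t); rewrite /up /low; split_ifs; lia. Qed.

Lemma zigzag_gap_w : has_gap zigzag_length zigzag w.
Proof. by apply: (@zigzag_gap_above p); rewrite /up /low; split_ifs; lia. Qed.

Lemma zigzag_gap_wd : has_gap zigzag_length zigzag (w + d).
Proof. by apply: (@zigzag_gap_below p); rewrite /up /low; split_ifs; lia. Qed.

Lemma zigzag_gap_b t : t < q -> has_gap zigzag_length zigzag (b t).
Proof.
move=> lt_tq; apply: (@zigzag_gap_above (p.+1 + t)); first lia.
rewrite /up /low; have -> : p.+1 + t - p.+1 = t by lia.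
by split_ifs; lia.
Qed.

Lemma zigzag_gap_b2 t : t < q -> has_gap zigzag_length zigzag (b t + 2).
Proof.
move=> lt_tq; apply: (@zigzag_gap_below (p.+1 + t)); first lia.
rewrite /up /low; have -> : p.+1 + t - p.+1 = t by lia.
by split_ifs; lia.
Qed.

Lemma zigzag0 : zigzag 0 = M.
Proof. by rewrite /zigzag /low /=; lia. Qed.

Lemma zigzag_last : zigzag (2 * (p + q).+1) = M - (2 * p + d) + 2 * q.
Proof. by rewrite /zigzag mul2n odd_double doubleK /low; split_ifs; lia. Qed.

(** The vertices fall into five families: two descending or ascending runs of low vertices, the
    upper vertices from [a] and from [b], and the one vertex below all low ones. *)
Lemma zigzagP (P : nat -> Prop) :
  (forall t, t <= p -> P (M - 2 * t)) ->
  (forall t, t <= q -> P (M - (2 * p + d) + 2 * t)) ->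
  (forall t, t < p -> P (M + (a t - 2 * t))) ->
  P (M - (2 * p + d + w)) ->
  (forall t, t < q -> P (M + (b t + 2 * t + 2 - (2 * p + d)))) ->
  forall u, u < zigzag_length -> P (zigzag u).
Proof.
move=> P1 P2 P3 P4 P5 u; rewrite /zigzag_length /zigzag => ltu.
case: ifP => odd_u.
  rewrite /up; case: ltnP => [ltp|lep].
    by have lt2 := a_gt ltp; have := P3 _ ltp; congr P; lia.
  case: eqP => [//|neq_p].
  have lt_tq : u./2 - p.+1 < q by lia.
  have := P5 _ lt_tq; have := b_gt lt_tq.
  by rewrite /low; split_ifs; move=> gt_x; congr P; lia.
rewrite /low; case: leqP => [lep|gtp]; first exact: P1.
by apply: P2; lia.
Qed.

Lemma zigzag_le u : u < zigzag_length -> zigzag u <= 2 * M.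
Proof.
move: u; apply: (@zigzagP (fun x => x <= 2 * M)) => [t _|t|t ltp||t ltq]; try lia.
  by have := zz_a_le zzP ltp; lia.
by have := zz_b_le zzP ltq; lia.
Qed.

(** As d is odd, the two runs of low vertices have opposite parities. *)
Lemma low_inj t t' : t <= (p + q).+1 -> t' <= (p + q).+1 -> low t = low t' -> t = t'.
Proof. by rewrite /low; split_ifs; lia. Qed.

Lemma up_inj t t' : t <= p + q -> t' <= p + q -> up t = up t' -> t = t'.
Proof.
have upP s : s <= p + q -> up s = if s < p then M + (a s - 2 * s) else
    if s == p then M - (2 * p + d + w) else
    M + (b (s - p.+1) + 2 * (s - p.+1) + 2 - (2 * p + d)).
  move=> les; rewrite /up /low; case: ltnP => [ltp|lep].
    by have := a_gt ltp; lia.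
  case: eqP => // neq_p; have lt_q : s - p.+1 < q by lia.
  by have := b_gt lt_q; split_ifs; lia.
wlog lt_tt' : t t' / t < t'.
  by move=> wl le_t le_t' eq_up; case: (ltngtP t t') => // lt; [|symmetry]; apply: wl.
move=> le_t le_t'; rewrite !upP //.
case: (ltnP t' p) => [ltp'|lep'].
  have ltp := ltn_trans lt_tt' ltp'; rewrite ltp.
  by have := zz_a_lt zzP lt_tt' ltp'; have := a_gt ltp; have := a_gt ltp'; split_ifs; lia.
case: (eqVneq t' p) => [eqp'|neqp'].
  by have ltp : t < p by [lia]; have := a_gt ltp; rewrite ltp; split_ifs; lia.
have ltq' : t' - p.+1 < q by lia.
have gt_b' := b_gt ltq'.
case: (ltnP t p) => [ltp|lep].
  by have := zz_ab_neq zzP ltp ltq'; have := a_gt ltp; split_ifs; lia.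
case: (eqVneq t p) => [eqp|neqp]; first by split_ifs; lia.
have ltq : t - p.+1 < q by lia.
have lt_q : t - p.+1 < t' - p.+1 by lia.
by have := b_gt ltq; have := zz_b_lt zzP lt_q ltq'; split_ifs; lia.
Qed.

(** Low vertices lie between M - (2p + d) and M; every other vertex lies outside that interval. *)
Lemma low_neq_up t t' : t <= (p + q).+1 -> t' <= p + q -> low t <> up t'.
Proof.
move=> le_t le_t'.
have lowP : M - (2 * p + d) <= low t <= M by rewrite /low; split_ifs; lia.
rewrite /up; case: ltnP => [ltp|lep]; first by have := a_gt ltp; lia.
case: eqP => [|neq_p]; first by lia.
have lt_q : t' - p.+1 < q by lia.
by have := b_gt lt_q; rewrite {2}/low; split_ifs; lia.
Qed.

Lemma zigzag_inj : {in gtn zigzag_length &, injective zigzag}.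
Proof.
move=> u u'; rewrite !inE /zigzag_length /zigzag => ltu ltu'.
case: ifP => odd_u; case: ifP => odd_u' eq_z.
- by have := up_inj _ _ eq_z; lia.
- by case: (@low_neq_up u'./2 u./2); lia.
- by case: (@low_neq_up u./2 u'./2); lia.
- by have := low_inj _ _ eq_z; lia.
Qed.

End Zigzag.

(** * Blocks of four consecutive differences *)

(** The blocks are dealt out in layers j of n blocks, one to each label s. Blocks with the same
    label are at least 4n apart, far more than the steps of the low vertices. *)
Definition quad (m n s j : nat) := m + 4 * (n * j + s).

Lemma quad_ge m n s j : 0 < n -> m + 4 * s + 4 * j <= quad m n s j.
Proof. by move=> n_gt0; have := leq_pmull j n_gt0; rewrite /quad; lia. Qed.

(** The product n * (j' - j - 1) is weakened to j' - j - 1 so that the bound stays linear. *)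
Lemma quad_gap m n s j j' : 0 < n -> j < j' ->
  quad m n s j + 4 * n + 4 * (j' - j.+1) <= quad m n s j'.
Proof.
move=> n_gt0 ltj; have := leq_pmull (j' - j.+1) n_gt0.
rewrite /quad; move: (j' - j.+1) (subnKC ltj) => i <-.
by rewrite !mulnDr mulnS; lia.
Qed.

Lemma quad_le m n s j j' : j <= j' -> quad m n s j <= quad m n s j'.
Proof. by move=> lej; rewrite /quad leq_add2l leq_mul2l /= leq_add2r leq_mul2l lej orbT. Qed.

(** Divide by 4, then by n. Layers below J are complete; layer J contains only the labels below
    s0. *)
Lemma quad_cover m n J s0 x : 0 < n -> m <= x < m + 4 * (n * J + s0) -> s0 <= n ->
  exists s j c, [/\ x = quad m n s j + c, s < n, c < 4 & (j < J) || (j == J) && (s < s0)].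
Proof.
move=> n_gt0 /andP[lemx ltx] les0.
pose y := (x - m) %/ 4; pose c := (x - m) %% 4.
exists (y %% n), (y %/ n), c.
have xE : x = m + 4 * y + c by rewrite /y /c; lia.
have ltc : c < 4 by rewrite /c ltn_mod.
have yE := divn_eq y n.
have ltyn := ltn_pmod y n_gt0.
split => //; first by rewrite /quad xE {1}yE mulnC; lia.
have lty : y < n * J + s0 by lia.
case: (ltngtP (y %/ n) J) => //= [ltJ|eqJ].
  by have := leq_mul (leqnn n) ltJ; rewrite mulnS; lia.
by rewrite eqJ in yE; lia.
Qed.

(** * Difference families for k = 3 mod 4 *)

Section ThreeModFour.

Variables (n o h P : nat).
Hypotheses (oh : o + h = n) (h_gt1 : 1 < h) (le_ho : h <= o) (le_oh : o <= h.+1).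

Let k := 4 * P + 7.
Let M := n * k.
(* The differences 1, ..., M are used in this order: the closing edges         *)
(* 1, ..., n; the pairs (w, w + d) of the odd rows, nested around n + o; those *)
(* of the even rows, nested around n + 2 * o + h; the quadruples               *)
(* quad3 s j + {0, 1, 2, 3}; the pairs (y i, y i + 1) and (z i, z i + 2) of    *)
(* the even rows.                                                              *)
Let quad3 := quad (3 * n + 1) n.
Let top := 3 * n + 4 * (n * P) + 4 * o.
Let y i := top + 1 + 2 * i.
Let z i := top + 2 * h + 1 + i + 2 * i./2.

(** The index i fixes the closing difference 2i + 1 and the pair (w, w + d), while s chooses only
    the blocks; this independence is what lets the blocks be permuted. In each block, [a] takes
    offsets 1 and 3 and [b] takes 0 and 2, with [b] in reverse order because b t + 2t must
    decrease. *)
Definition odd_row3 s i :=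
  zigzag M P.+1 (2 * i + 1) (n + o - i)
    (fun t => (quad3 s t).+1) (fun t => quad3 s (P - t)).

(** The path M - 1, M - 1 - y, M uses the differences y and y + 1 and changes the closing difference
    to 2i + 2. The value [z i] exceeds all the blocks of the row and therefore comes last in [a]. *)
Definition even_row3 i :=
  prepend (M - 1) (M - 1 - y i)
    (zigzag M P.+1 (2 * i + 1) (n + 2 * o + h - i)
      (fun t => if t < P then (quad3 (o + i) t).+1 else z i)
      (fun t => quad3 (o + i) (P - t.+1))).

Let n_gt0 : 0 < n. Proof. by lia. Qed.

Let ME : M = 7 * n + 4 * (n * P).
Proof. by rewrite /M /k; lia. Qed.

Let le_PnP : 2 * P <= n * P.
Proof. by rewrite leq_mul2r; lia. Qed.

Let quad3_ge s j : 3 * n + 1 + 4 * s + 4 * j <= quad3 s j.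
Proof. exact: quad_ge. Qed.

Let quad3_le s j : s < o -> j <= P -> quad3 s j + 3 <= top.
Proof. by move=> lts /(quad_le (3 * n + 1) n s); rewrite /quad3 /top /quad; lia. Qed.

Let quad3_lt s j : s < n -> j < P -> quad3 s j + 3 <= 3 * n + 4 * (n * P).
Proof.
by move=> lts ltj; have := @quad_gap (3 * n + 1) n s j P n_gt0 ltj; rewrite /quad3 /quad; lia.
Qed.

Lemma odd_row3_spec s i : s < o -> i < o ->
  zigzag_spec M P.+1 P.+1 (2 * i + 1) (n + o - i)
    (fun t => (quad3 s t).+1) (fun t => quad3 s (P - t)).
Proof.
move=> lts lti; split.
- by rewrite ME; lia.
- by lia.
- by lia.
- by lia.
- by move=> t _; have := quad3_ge s t; lia.
- by move=> t ltt; have := quad3_ge s (P - t); lia.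
- by move=> t; rewrite ltnS => /(quad3_le lts); rewrite ME /top; lia.
- by move=> t ltt; have := @quad3_le s (P - t) lts (leq_subr _ _); rewrite ME /top; lia.
- by move=> t t' ltt _; have := quad_gap (3 * n + 1) s n_gt0 ltt; rewrite -/quad3; lia.
- move=> t t' ltt ltP; have ltt' : P - t' < P - t by lia.
  by have := quad_gap (3 * n + 1) s n_gt0 ltt'; rewrite -/quad3; lia.
- move=> t t' ltP ltP'.
  case: (ltngtP t (P - t')) => [ltt|ltt|->]; last by lia.
    by have := quad_gap (3 * n + 1) s n_gt0 ltt; rewrite -/quad3; lia.
  by have := quad_gap (3 * n + 1) s n_gt0 ltt; rewrite -/quad3; lia.
Qed.

Lemma even_row3_spec i : i < h ->
  zigzag_spec M P.+1 P (2 * i + 1) (n + 2 * o + h - i)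
    (fun t => if t < P then (quad3 (o + i) t).+1 else z i)
    (fun t => quad3 (o + i) (P - t.+1)).
Proof.
move=> lti; have lts : o + i < n by lia.
have zE : z i = top + 2 * h + 1 + i + 2 * i./2 by [].
split.
- by rewrite ME; lia.
- by lia.
- by lia.
- by lia.
- move=> t ltt; case: ifP => _; last by rewrite zE /top; lia.
  by have := quad3_ge (o + i) t; lia.
- by move=> t ltt; have := quad3_ge (o + i) (P - t.+1); lia.
- move=> t ltt; case: ifP => [ltP|_]; last by rewrite zE ME /top; lia.
  by have := quad3_lt lts ltP; rewrite ME; lia.
- move=> t ltt; have ltP : P - t.+1 < P by lia.
  by have := quad3_lt lts ltP; rewrite ME; lia.
- move=> t t' ltt ltP; have -> : t < P by lia.
  case: ifP => [ltP'|geP'].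
    by have := quad_gap (3 * n + 1) (o + i) n_gt0 ltt; rewrite -/quad3; lia.
  have ltP' : t < P by lia.
  by have := quad_gap (3 * n + 1) (o + i) n_gt0 ltP'; rewrite zE /top /quad3 /quad; lia.
- move=> t t' ltt ltP; have ltt' : P - t'.+1 < P - t.+1 by lia.
  by have := quad_gap (3 * n + 1) (o + i) n_gt0 ltt'; rewrite -/quad3; lia.
- move=> t t' ltP ltP'; case: ifP => [ltPt|gePt].
    case: (ltngtP t (P - t'.+1)) => [ltt|ltt|->]; last by lia.
      by have := quad_gap (3 * n + 1) (o + i) n_gt0 ltt; rewrite -/quad3; lia.
    by have := quad_gap (3 * n + 1) (o + i) n_gt0 ltt; rewrite -/quad3; lia.
  have ltP'' : P - t'.+1 < P by lia.
  by have := quad_gap (3 * n + 1) (o + i) n_gt0 ltP''; rewrite zE /top /quad3 /quad; lia.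
Qed.

Let kE_odd : k = zigzag_length P.+1 P.+1.
Proof. by rewrite /k /zigzag_length; lia. Qed.

Let kE_even : k = (zigzag_length P.+1 P).+2.
Proof. by rewrite /k /zigzag_length; lia. Qed.

Lemma odd_row3_inj s i : s < o -> i < o -> {in gtn k &, injective (odd_row3 s i)}.
Proof. by move=> lts lti; rewrite kE_odd; apply: zigzag_inj (odd_row3_spec lts lti). Qed.

Lemma odd_row3_le s i u : s < o -> i < o -> u < k -> odd_row3 s i u <= 2 * M.
Proof. by move=> lts lti; rewrite kE_odd; apply: zigzag_le (odd_row3_spec lts lti) _. Qed.

Lemma even_row3_inj i : i < h -> {in gtn k &, injective (even_row3 i)}.
Proof.
move=> lti; have zz := even_row3_spec lti; rewrite kE_even.
have yM : y i + 3 <= M by rewrite ME /y /top; lia.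
have y_gt : 2 * P.+1 + (2 * i + 1) + (n + 2 * o + h - i) < y i + 1 by rewrite /y /top; lia.
apply: prepend_inj; last exact: zigzag_inj zz.
- by rewrite /y /top; lia.
- apply: (zigzagP zz (P := fun x => x <> M - 1)) => [t|t|t ltt||t ltt]; lia.
- apply: (zigzagP zz (P := fun x => x <> M - 1 - y i)) => [t|t|t ltt||t ltt]; lia.
Qed.

Lemma even_row3_le i u : i < h -> u < k -> even_row3 i u <= 2 * M.
Proof.
move=> lti; rewrite kE_even; case: u => [|[|u]] ltu; rewrite /even_row3 /=; try lia.
exact: zigzag_le (even_row3_spec lti) _ _.
Qed.

Variable sg : nat -> nat.
Hypothesis sg_lt : forall i, i < o -> sg i < o.
Hypothesis sg_surj : forall s, s < o -> exists2 i, i < o & sg i = s.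

Definition family3 r := if r < o then odd_row3 (sg r) r else even_row3 (r - o).

Let v := 2 * n * k + 1.

Let family3_odd i d : i < o -> has_difference v k (odd_row3 (sg i) i) d ->
  exists2 r, r < n & has_difference v k (family3 r) d.
Proof. by move=> lti dif; exists i; rewrite /family3 ?lti //; lia. Qed.

Let family3_even i d : i < h -> has_difference v k (even_row3 i) d ->
  exists2 r, r < n & has_difference v k (family3 r) d.
Proof.
move=> lti dif; exists (o + i); first by lia.
by rewrite /family3 ifF ?addKn //; lia.
Qed.

Lemma odd_row3_gap s i d : has_gap (zigzag_length P.+1 P.+1) (odd_row3 s i) d ->
  has_difference v k (odd_row3 s i) d.
Proof. by rewrite kE_odd; apply: has_gap_difference. Qed.

Lemma even_row3_gap i d : has_gap (zigzag_length P.+1 P).+2 (even_row3 i) d ->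
  has_difference v k (even_row3 i) d.
Proof. by rewrite kE_even; apply: has_gap_difference. Qed.

Lemma odd_row3_closing s i : s < o -> i < o ->
  has_difference v k (odd_row3 s i) (2 * i + 1).
Proof.
move=> lts lti; have zz := odd_row3_spec lts lti.
rewrite kE_odd; apply: closing_difference.
by rewrite /odd_row3 (zigzag_last zz) (zigzag0 zz) ME; lia.
Qed.

Lemma odd_row3_quad s i : s < o -> i < o ->
  has_difference v k (odd_row3 s i) (quad3 s 0).+1.
Proof.
move=> lts lti; apply: odd_row3_gap.
exact: (zigzag_gap_a (odd_row3_spec lts lti) (ltn0Sn P)).
Qed.

Let cover_small d : 0 < d <= n ->
  exists2 r, r < n & has_difference v k (family3 r) d.
Proof.
move=> bd_d; case: (boolP (odd d)) => odd_d.
  have lti : d./2 < o by lia.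
  apply: (family3_odd lti); have -> : d = 2 * d./2 + 1 by lia.
  have -> : (2 * d./2 + 1)./2 = d./2 by lia.
  exact: odd_row3_closing (sg_lt lti) lti.
have lti : d./2.-1 < h by lia.
apply: (family3_even lti); rewrite kE_even; apply: closing_difference.
by rewrite /even_row3 /= (zigzag_last (even_row3_spec lti)) ME; lia.
Qed.

Let cover_odd_nest d : n < d <= n + 2 * o ->
  exists2 r, r < n & has_difference v k (family3 r) d.
Proof.
move=> bd_d; case: (leqP d (n + o)) => le_d.
  have lti : n + o - d < o by lia.
  apply/(family3_odd lti)/odd_row3_gap.
  have := zigzag_gap_w (odd_row3_spec (sg_lt lti) lti).
  by congr has_gap; lia.
have lti : d - (n + o).+1 < o by lia.
apply/(family3_odd lti)/odd_row3_gap.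
have := zigzag_gap_wd (odd_row3_spec (sg_lt lti) lti).
by congr has_gap; lia.
Qed.

Let cover_even_nest d : n + 2 * o < d <= 3 * n ->
  exists2 r, r < n & has_difference v k (family3 r) d.
Proof.
move=> bd_d; case: (leqP d (n + 2 * o + h)) => le_d.
  have lti : n + 2 * o + h - d < h by lia.
  apply/(family3_even lti)/even_row3_gap/has_gap_prepend.
  have := zigzag_gap_w (even_row3_spec lti).
  by congr has_gap; lia.
have lti : d - (n + 2 * o + h).+1 < h by lia.
apply/(family3_even lti)/even_row3_gap/has_gap_prepend.
have := zigzag_gap_wd (even_row3_spec lti).
by congr has_gap; lia.
Qed.

Let cover_quad d : 3 * n < d <= top ->
  exists2 r, r < n & has_difference v k (family3 r) d.
Proof.
move=> bd_d.
have [||s [j [c [-> lts ltc Js]]]] := @quad_cover (3 * n + 1) n P o d n_gt0.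
- by rewrite /top in bd_d; lia.
- by lia.
rewrite -/(quad3 s j).
case: (ltnP s o) => [lts'|le_os].
  have [i lti sgi] := sg_surj lts'.
  have lej : j < P.+1 by lia.
  have lej' : P - j < P.+1 by lia.
  have jE : P - (P - j) = j by lia.
  have zz := odd_row3_spec lts' lti.
  apply: (family3_odd lti); rewrite sgi; apply: odd_row3_gap.
  case: c ltc => [|[|[|[|c]]]] // _.
  - by have := zigzag_gap_b zz lej'; congr has_gap; rewrite jE addn0.
  - by have := zigzag_gap_a zz lej; congr has_gap; rewrite addn1.
  - by have := zigzag_gap_b2 zz lej'; congr has_gap; rewrite jE.
  - by have := zigzag_gap_a2 zz lej; congr has_gap; rewrite addSnnS.
have ltj : j < P by lia.
have ltj' : P - j.+1 < P by lia.
have jE : P - (P - j.+1).+1 = j by lia.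
have lti : s - o < h by lia.
have sE : o + (s - o) = s by lia.
have zz := even_row3_spec lti.
apply/(family3_even lti)/even_row3_gap/has_gap_prepend.
case: c ltc => [|[|[|[|c]]]] // _.
- by have := zigzag_gap_b zz ltj'; congr has_gap; rewrite jE addn0 sE.
- by have := zigzag_gap_a zz (leqW ltj); congr has_gap; rewrite ltj addn1 sE.
- by have := zigzag_gap_b2 zz ltj'; congr has_gap; rewrite jE sE.
- by have := zigzag_gap_a2 zz (leqW ltj); congr has_gap; rewrite ltj addSnnS sE.
Qed.

Let cover_lone d : top < d <= top + 2 * h ->
  exists2 r, r < n & has_difference v k (family3 r) d.
Proof.
move=> bd_d; have lti : (d - top.+1)./2 < h by lia.
have yM : y (d - top.+1)./2 + 3 <= M by rewrite ME /y /top; lia.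
apply/(family3_even lti)/even_row3_gap.
case: (boolP (odd (d - top.+1))) => odd_d.
  by apply: prepend_gap => //; rewrite (zigzag0 (even_row3_spec lti)) /y in yM *; lia.
by apply: prepend_gap0; rewrite /y in yM *; lia.
Qed.

Let cover_top d : top + 2 * h < d <= M ->
  exists2 r, r < n & has_difference v k (family3 r) d.
Proof.
move=> bd_d.
pose c := d - (top + 2 * h).+1.
have ltc : c < 2 * h by rewrite ME in bd_d; rewrite /c /top; lia.
have dE : d = (top + 2 * h).+1 + c by rewrite /c; lia.
(* This inverts [z]: two rows share four consecutive values, the parity of c selects the row, and c
   mod 4 decides between z and z + 2. *)
pose i := 2 * (c %/ 4) + odd c.
have P_notlt : (P < P) = false by rewrite ltnn.
have gap j : j < h -> has_gap (zigzag_length P.+1 P).+2 (even_row3 j) (z j) /\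
    has_gap (zigzag_length P.+1 P).+2 (even_row3 j) (z j + 2).
  move=> ltj; have zz := even_row3_spec ltj; split; apply: has_gap_prepend.
    by have := zigzag_gap_a zz (ltnSn P); rewrite P_notlt.
  by have := zigzag_gap_a2 zz (ltnSn P); rewrite P_notlt.
case: (ltnP i h) => [lti|le_hi].
  have [gap0 gap2] := gap i lti.
  apply/(family3_even lti)/even_row3_gap.
  case: (ltnP (c %% 4) 2) => lt2.
    by move: gap0; congr has_gap; rewrite /z /i dE; lia.
  by move: gap2; congr has_gap; rewrite /z /i dE; lia.
(* If h is odd, then M + 1 = - M mod 2M + 1 is used in place of M.            *)
have lti : h.-1 < h by lia.
have [_ gap2] := gap _ lti.
apply: (family3_even lti); rewrite kE_even; apply: has_gap_complement.
  by rewrite /v -mulnA -/M; lia.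
move: gap2; congr has_gap.
have -> : v = 2 * M + 1 by rewrite /v -mulnA.
have cE : c = (2 * h).-1 by rewrite /i in le_hi; lia.
have : M = top + 4 * h by rewrite ME /top; lia.
by rewrite dE cE /z => ->; rewrite /i in le_hi; lia.
Qed.

Lemma family3_difference_family : difference_family n k family3.
Proof.
have vE : 2 * n * k = 2 * M by rewrite -mulnA.
split=> [r u ltr ltu|r ltr|d bd_d].
- rewrite vE addn1 ltnS /family3; case: ltnP => ltro.
    exact: odd_row3_le (sg_lt ltro) ltro ltu.
  by apply: even_row3_le => //; lia.
- rewrite /family3; case: ltnP => ltro; first exact: odd_row3_inj (sg_lt ltro) ltro.
  by apply: even_row3_inj; lia.
- rewrite -/M -/v in bd_d *.
  have [le1|gt1] := leqP d n; first by apply: cover_small; lia.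
  have [le2|gt2] := leqP d (n + 2 * o); first by apply: cover_odd_nest; lia.
  have [le3|gt3] := leqP d (3 * n); first by apply: cover_even_nest; lia.
  have [le4|gt4] := leqP d top; first by apply: cover_quad; lia.
  have [le5|gt5] := leqP d (top + 2 * h); first by apply: cover_lone; lia.
  by apply: cover_top; lia.
Qed.

End ThreeModFour.

(** * Difference families for k = 1 mod 4 *)

Section OneModFour.

Variables (n o h P : nat).
Hypotheses (oh : o + h = n) (h_gt1 : 1 < h) (le_ho : h <= o) (le_oh : o <= h.+1).

Let k := 4 * P + 9.
Let M := n * k.
(* The differences 1, ..., M are used in this order: the closing edges         *)
(* 1, ..., n; the pairs (w, w + d) of the odd rows, nested around the pair     *)
(* (y 0, y 0 + 1); those of the even rows; the quadruples                      *)
(* quad1 s j + {0, 1, 2, 3}; the pairs (y i, y i + 1), i > 0, of the even      *)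
(* rows; the pairs (z i, z i + 2) of the odd rows.                             *)
Let quad1 := quad (3 * n + 3) n.
Let top := 7 * n + 4 * (n * P).
Let y i := if i == 0 then n + o + 1 else top + 1 + 2 * i.
Let z i := top + 2 * h + 1 + i + 2 * i./2.

(** Here q = p + 1, so d = 2i + 3 is needed for the closing difference 2i + 1. The nested pairs then
    leave two middle values free, and these form the pair of [y 0]. The large value [z i] comes
    first in the decreasing sequence [b]. *)
Definition odd_row1 s i :=
  zigzag M P.+1 (2 * i + 3) (n + o - i)
    (fun t => (quad1 s t).+1) (fun t => if t == 0 then z i else quad1 s (P.+1 - t)).

(** The extra vertices lie above M. Among the upper vertices, M + y i + 1 is below those coming from
    the blocks if i = 0 and above them otherwise. *)
Definition even_row1 i :=
  prepend (M + 1) (M + y i + 1)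
    (zigzag M P.+1 (2 * i + 1) (n + 2 * o + 2 + h - i)
      (fun t => (quad1 (o + i) t).+1) (fun t => quad1 (o + i) (P - t))).

Let n_gt0 : 0 < n. Proof. by lia. Qed.

Let ME : M = 9 * n + 4 * (n * P).
Proof. by rewrite /M /k; lia. Qed.

Let le_PnP : 2 * P <= n * P.
Proof. by rewrite leq_mul2r; lia. Qed.

Let quad1_ge s j : 3 * n + 3 + 4 * s + 4 * j <= quad1 s j.
Proof. exact: quad_ge. Qed.

Let quad1_le s j : s < n -> j <= P -> quad1 s j + 4 * (P - j) + 1 <= top.
Proof.
move=> lts; rewrite leq_eqVlt => /orP[/eqP->|ltj].
  by rewrite /quad1 /quad /top; lia.
have := quad_gap (3 * n + 3) s n_gt0 ltj.
have -> : quad (3 * n + 3) n s P = 3 * n + 3 + 4 * (n * P + s) by [].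
by rewrite -/quad1 /top; lia.
Qed.

Let quad1_neq s j t i : j <= P -> t <= P -> i < o ->
  quad1 s t + 2 * i + 2 + 2 * j <> quad1 s j + 2 * t.
Proof.
move=> lej let_ lti; case: (ltngtP t j) => [ltt|ltt|->]; last by lia.
  by have := quad_gap (3 * n + 3) s n_gt0 ltt; rewrite -/quad1; lia.
by have := quad_gap (3 * n + 3) s n_gt0 ltt; rewrite -/quad1; lia.
Qed.

Lemma odd_row1_spec s i : s < o -> i < o ->
  zigzag_spec M P.+1 P.+2 (2 * i + 3) (n + o - i)
    (fun t => (quad1 s t).+1) (fun t => if t == 0 then z i else quad1 s (P.+1 - t)).
Proof.
move=> lts lti; have ltsn : s < n by lia.
have zE : z i = top + 2 * h + 1 + i + 2 * i./2 by [].
split.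
- by rewrite ME; lia.
- by lia.
- by lia.
- by lia.
- by move=> t _; have := quad1_ge s t; lia.
- move=> [_|t ltt] /=; first by rewrite zE /top; lia.
  by have := quad1_ge s (P - t); rewrite subSS; lia.
- by move=> t ltt; have := @quad1_le s t ltsn ltt; rewrite ME /top; lia.
- move=> [_|t ltt] /=; first by rewrite zE ME /top; lia.
  by have := @quad1_le s (P - t) ltsn (leq_subr _ _); rewrite ME /top subSS; lia.
- by move=> t t' ltt _; have := quad_gap (3 * n + 3) s n_gt0 ltt; rewrite -/quad1; lia.
- move=> [|t] [|t'] //= ltt ltP; rewrite !subSS.
    by have := @quad1_le s (P - t') ltsn (leq_subr _ _); rewrite zE; lia.
  have ltt' : P - t' < P - t by lia.
  by have := quad_gap (3 * n + 3) s n_gt0 ltt'; rewrite -/quad1; lia.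
- move=> t [|t'] ltP ltP' /=.
    by have := @quad1_le s t ltsn ltP; rewrite zE; lia.
  by have := @quad1_neq s (P - t') t i (leq_subr _ _) ltP lti; rewrite subSS; lia.
Qed.

Lemma even_row1_spec i : i < h ->
  zigzag_spec M P.+1 P.+1 (2 * i + 1) (n + 2 * o + 2 + h - i)
    (fun t => (quad1 (o + i) t).+1) (fun t => quad1 (o + i) (P - t)).
Proof.
move=> lti; have lts : o + i < n by lia.
split.
- by rewrite ME; lia.
- by lia.
- by lia.
- by lia.
- by move=> t ltt; have := quad1_ge (o + i) t; lia.
- by move=> t ltt; have := quad1_ge (o + i) (P - t); lia.
- by move=> t ltt; have := @quad1_le (o + i) t lts ltt; rewrite ME /top; lia.
- by move=> t ltt; have := @quad1_le (o + i) (P - t) lts (leq_subr _ _); rewrite ME /top; lia.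
- by move=> t t' ltt _; have := quad_gap (3 * n + 3) (o + i) n_gt0 ltt; rewrite -/quad1; lia.
- move=> t t' ltt ltP; have ltt' : P - t' < P - t by lia.
  by have := quad_gap (3 * n + 3) (o + i) n_gt0 ltt'; rewrite -/quad1; lia.
- move=> t t' ltP ltP'; have ltio : i < o by lia.
  by have := @quad1_neq (o + i) (P - t') t i (leq_subr _ _) ltP ltio; lia.
Qed.

Let kE_odd : k = zigzag_length P.+1 P.+2.
Proof. by rewrite /k /zigzag_length; lia. Qed.

Let kE_even : k = (zigzag_length P.+1 P.+1).+2.
Proof. by rewrite /k /zigzag_length; lia. Qed.

Lemma odd_row1_inj s i : s < o -> i < o -> {in gtn k &, injective (odd_row1 s i)}.
Proof. by move=> lts lti; rewrite kE_odd; apply: zigzag_inj (odd_row1_spec lts lti). Qed.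

Lemma odd_row1_le s i u : s < o -> i < o -> u < k -> odd_row1 s i u <= 2 * M.
Proof. by move=> lts lti; rewrite kE_odd; apply: zigzag_le (odd_row1_spec lts lti) _. Qed.

Let even_row1_lone i : i < h -> y i + 1 <= M.
Proof. by rewrite ME /y /top; case: eqP => _; lia. Qed.

Lemma even_row1_inj i : i < h -> {in gtn k &, injective (even_row1 i)}.
Proof.
move=> lti; have zz := even_row1_spec lti; rewrite kE_even.
have lts : o + i < n by lia.
have y_gt0 : 0 < y i by rewrite /y; case: eqP => _; lia.
apply: prepend_inj; last exact: zigzag_inj zz.
- by lia.
- apply: (zigzagP zz (P := fun x => x <> M + 1)) => [t|t|t ltt||t ltt]; try lia.
    by have := quad1_ge (o + i) t; lia.
  by have := quad1_ge (o + i) (P - t); lia.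
- apply: (zigzagP zz (P := fun x => x <> M + y i + 1)) => [t|t|t ltt||t ltt]; try lia.
    have := quad1_ge (o + i) t; have := @quad1_le (o + i) t lts ltt.
    by rewrite /y; case: eqP => _; lia.
  have := quad1_ge (o + i) (P - t).
  have := @quad1_le (o + i) (P - t) lts (leq_subr _ _).
  by rewrite /y; case: eqP => _; lia.
Qed.

Lemma even_row1_le i u : i < h -> u < k -> even_row1 i u <= 2 * M.
Proof.
move=> lti; have := even_row1_lone lti.
rewrite kE_even; case: u => [|[|u]] leM ltu; rewrite /even_row1 /=; try lia.
exact: zigzag_le (even_row1_spec lti) _ _.
Qed.

Variable sg : nat -> nat.
Hypothesis sg_lt : forall i, i < o -> sg i < o.
Hypothesis sg_surj : forall s, s < o -> exists2 i, i < o & sg i = s.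

Definition family1 r := if r < o then odd_row1 (sg r) r else even_row1 (r - o).

Let v := 2 * n * k + 1.

Let family1_odd i d : i < o -> has_difference v k (odd_row1 (sg i) i) d ->
  exists2 r, r < n & has_difference v k (family1 r) d.
Proof. by move=> lti dif; exists i; rewrite /family1 ?lti //; lia. Qed.

Let family1_even i d : i < h -> has_difference v k (even_row1 i) d ->
  exists2 r, r < n & has_difference v k (family1 r) d.
Proof.
move=> lti dif; exists (o + i); first by lia.
by rewrite /family1 ifF ?addKn //; lia.
Qed.

Lemma odd_row1_gap s i d : has_gap (zigzag_length P.+1 P.+2) (odd_row1 s i) d ->
  has_difference v k (odd_row1 s i) d.
Proof. by rewrite kE_odd; apply: has_gap_difference. Qed.

Lemma even_row1_gap i d : has_gap (zigzag_length P.+1 P.+1).+2 (even_row1 i) d ->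
  has_difference v k (even_row1 i) d.
Proof. by rewrite kE_even; apply: has_gap_difference. Qed.

Lemma odd_row1_closing s i : s < o -> i < o ->
  has_difference v k (odd_row1 s i) (2 * i + 1).
Proof.
move=> lts lti; have zz := odd_row1_spec lts lti.
rewrite kE_odd; apply: closing_difference.
by rewrite /odd_row1 (zigzag_last zz) (zigzag0 zz) ME; lia.
Qed.

Lemma odd_row1_quad s i : s < o -> i < o ->
  has_difference v k (odd_row1 s i) (quad1 s 0).+1.
Proof.
move=> lts lti; apply: odd_row1_gap.
exact: (zigzag_gap_a (odd_row1_spec lts lti) (ltn0Sn P)).
Qed.

Let cover_small d : 0 < d <= n ->
  exists2 r, r < n & has_difference v k (family1 r) d.
Proof.
move=> bd_d; case: (boolP (odd d)) => odd_d.
  have lti : d./2 < o by lia.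
  apply: (family1_odd lti); have -> : d = 2 * d./2 + 1 by lia.
  have -> : (2 * d./2 + 1)./2 = d./2 by lia.
  exact: odd_row1_closing (sg_lt lti) lti.
have lti : d./2.-1 < h by lia.
apply: (family1_even lti); rewrite kE_even; apply: closing_difference.
by rewrite /even_row1 /= (zigzag_last (even_row1_spec lti)) ME; lia.
Qed.

Let even_row1_lone_gap i : i < h ->
  has_difference v k (even_row1 i) (y i) /\ has_difference v k (even_row1 i) (y i + 1).
Proof.
move=> lti; split; apply: even_row1_gap; first by apply: prepend_gap0; lia.
by apply: prepend_gap => //; rewrite (zigzag0 (even_row1_spec lti)); lia.
Qed.

Let cover_odd_nest d : n < d <= n + 2 * o + 2 ->
  exists2 r, r < n & has_difference v k (family1 r) d.
Proof.
move=> bd_d; case: (leqP d (n + o)) => le_d.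
  have lti : n + o - d < o by lia.
  apply/(family1_odd lti)/odd_row1_gap.
  have := zigzag_gap_w (odd_row1_spec (sg_lt lti) lti).
  by congr has_gap; lia.
have [gap0 gap1] := even_row1_lone_gap (ltnW h_gt1).
case: (eqVneq d (n + o + 1)) => [->|neq1]; first exact: family1_even (ltnW h_gt1) gap0.
case: (eqVneq d (n + o + 1 + 1)) => [->|neq2]; first exact: family1_even (ltnW h_gt1) gap1.
have lti : d - (n + o + 3) < o by lia.
apply/(family1_odd lti)/odd_row1_gap.
have := zigzag_gap_wd (odd_row1_spec (sg_lt lti) lti).
by congr has_gap; lia.
Qed.

Let cover_even_nest d : n + 2 * o + 2 < d <= 3 * n + 2 ->
  exists2 r, r < n & has_difference v k (family1 r) d.
Proof.
move=> bd_d; case: (leqP d (n + 2 * o + 2 + h)) => le_d.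
  have lti : n + 2 * o + 2 + h - d < h by lia.
  apply/(family1_even lti)/even_row1_gap/has_gap_prepend.
  have := zigzag_gap_w (even_row1_spec lti).
  by congr has_gap; lia.
have lti : d - (n + 2 * o + 2 + h).+1 < h by lia.
apply/(family1_even lti)/even_row1_gap/has_gap_prepend.
have := zigzag_gap_wd (even_row1_spec lti).
by congr has_gap; lia.
Qed.

Let cover_quad d : 3 * n + 2 < d <= top + 2 ->
  exists2 r, r < n & has_difference v k (family1 r) d.
Proof.
move=> bd_d.
have [||s [j [c [-> lts ltc Js]]]] := @quad_cover (3 * n + 3) n P.+1 0 d n_gt0.
- by rewrite /top in bd_d; lia.
- by lia.
rewrite -/(quad1 s j).
have lej : j < P.+1 by lia.
case: (ltnP s o) => [lts'|le_os].
  have [i lti sgi] := sg_surj lts'.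
  have lej' : (P - j).+1 < P.+2 by lia.
  have jE : P.+1 - (P - j).+1 = j by lia.
  have zz := odd_row1_spec lts' lti.
  apply: (family1_odd lti); rewrite sgi; apply: odd_row1_gap.
  case: c ltc => [|[|[|[|c]]]] // _.
  - by have := zigzag_gap_b zz lej'; congr has_gap; rewrite jE addn0.
  - by have := zigzag_gap_a zz lej; congr has_gap; rewrite addn1.
  - by have := zigzag_gap_b2 zz lej'; congr has_gap; rewrite jE.
  - by have := zigzag_gap_a2 zz lej; congr has_gap; rewrite addSnnS.
have ltj' : P - j < P.+1 by lia.
have jE : P - (P - j) = j by lia.
have lti : s - o < h by lia.
have sE : o + (s - o) = s by lia.
have zz := even_row1_spec lti.
apply/(family1_even lti)/even_row1_gap/has_gap_prepend.
case: c ltc => [|[|[|[|c]]]] // _.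
- by have := zigzag_gap_b zz ltj'; congr has_gap; rewrite jE addn0 sE.
- by have := zigzag_gap_a zz lej; congr has_gap; rewrite addn1 sE.
- by have := zigzag_gap_b2 zz ltj'; congr has_gap; rewrite jE sE.
- by have := zigzag_gap_a2 zz lej; congr has_gap; rewrite addSnnS sE.
Qed.

Let cover_lone d : top + 2 < d <= top + 2 * h ->
  exists2 r, r < n & has_difference v k (family1 r) d.
Proof.
move=> bd_d; have lti : (d - top.+1)./2 < h by lia.
have yE : y (d - top.+1)./2 = top + 1 + 2 * (d - top.+1)./2.
  by rewrite /y; case: eqP => //; lia.
have [gap0 gap1] := even_row1_lone_gap lti.
apply: (family1_even lti); case: (boolP (odd (d - top.+1))) => odd_d.
  by move: gap1; congr has_difference; rewrite yE; lia.
by move: gap0; congr has_difference; rewrite yE; lia.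
Qed.

Let cover_top d : top + 2 * h < d <= M ->
  exists2 r, r < n & has_difference v k (family1 r) d.
Proof.
move=> bd_d.
pose c := d - (top + 2 * h).+1.
have ltc : c < 2 * o by rewrite ME in bd_d; rewrite /c /top; lia.
have dE : d = (top + 2 * h).+1 + c by rewrite /c; lia.
pose i := 2 * (c %/ 4) + odd c.
have gap j : j < o -> has_gap (zigzag_length P.+1 P.+2) (odd_row1 (sg j) j) (z j) /\
    has_gap (zigzag_length P.+1 P.+2) (odd_row1 (sg j) j) (z j + 2).
  move=> ltj; have zz := odd_row1_spec (sg_lt ltj) ltj.
  by split; [have := zigzag_gap_b zz (ltn0Sn _) | have := zigzag_gap_b2 zz (ltn0Sn _)].
case: (ltnP i o) => [lti|le_oi].
  have [gap0 gap2] := gap i lti.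
  apply/(family1_odd lti)/odd_row1_gap.
  case: (ltnP (c %% 4) 2) => lt2.
    by move: gap0; congr has_gap; rewrite /z /i dE; lia.
  by move: gap2; congr has_gap; rewrite /z /i dE; lia.
(* If o is odd, then M + 1 = - M mod 2M + 1 is used in place of M.            *)
have lti : o.-1 < o by lia.
have [_ gap2] := gap _ lti.
apply: (family1_odd lti); rewrite kE_odd; apply: has_gap_complement.
  by rewrite /v -mulnA -/M; lia.
move: gap2; congr has_gap.
have -> : v = 2 * M + 1 by rewrite /v -mulnA.
have cE : c = (2 * o).-1 by rewrite /i in le_oi; lia.
have : M = top + 2 * h + 2 * o by rewrite ME /top; lia.
by rewrite dE cE /z => ->; rewrite /i in le_oi; lia.
Qed.

Lemma family1_difference_family : difference_family n k family1.
Proof.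
have vE : 2 * n * k = 2 * M by rewrite -mulnA.
split=> [r u ltr ltu|r ltr|d bd_d].
- rewrite vE addn1 ltnS /family1; case: ltnP => ltro.
    exact: odd_row1_le (sg_lt ltro) ltro ltu.
  by apply: even_row1_le => //; lia.
- rewrite /family1; case: ltnP => ltro; first exact: odd_row1_inj (sg_lt ltro) ltro.
  by apply: even_row1_inj; lia.
- rewrite -/M -/v in bd_d *.
  have [le1|gt1] := leqP d n; first by apply: cover_small; lia.
  have [le2|gt2] := leqP d (n + 2 * o + 2); first by apply: cover_odd_nest; lia.
  have [le3|gt3] := leqP d (3 * n + 2); first by apply: cover_even_nest; lia.
  have [le4|gt4] := leqP d (top + 2); first by apply: cover_quad; lia.
  have [le5|gt5] := leqP d (top + 2 * h); first by apply: cover_lone; lia.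
  by apply: cover_top; lia.
Qed.

End OneModFour.

(** * Counting *)

Lemma uphalf_fact_le_NC (n k : nat) : 3 < n -> 5 < k -> odd k ->
  (uphalf n)`! <= NC (2 * n * k + 1) k * (2 * n * k + 1).
Proof.
move=> n_gt3 k_gt5 odd_k.
pose o := uphalf n; pose h := n./2.
have oh : o + h = n by rewrite /o /h; lia.
have h_gt1 : 1 < h by rewrite /h; lia.
have le_ho : h <= o by rewrite /o /h; lia.
have le_oh : o <= h.+1 by rewrite /o /h; lia.
(* The permutation is extended by the identity to all natural numbers. *)
pose sg (s : {perm 'I_o}) r := oapp (fun i => nat_of_ord (s i)) r (insub r).
have sgE s (i : 'I_o) : sg s i = s i by rewrite /sg valK.
have sg_lt s i : i < o -> sg s i < o.
  by move=> lti; rewrite -[i]/(nat_of_ord (Ordinal lti)) sgE.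
have sg_surj s j : j < o -> exists2 i, i < o & sg s i = j.
  by move=> ltj; exists ((s^-1)%g (Ordinal ltj)); rewrite ?sgE ?permKV.
have quad_lt m i : i < o -> m <= 3 * n + 3 -> 0 < (quad m n i 0).+1 <= n * k.
  move=> lti lem; rewrite /quad muln0 add0n /=.
  by have := leq_mul (leqnn n) k_gt5; lia.
have key_lt i : i < o -> 0 < 2 * i + 1 <= n * k.
  by move=> lti; have := leq_mul (leqnn n) k_gt5; lia.
have n_gt0 : 0 < n by lia.
have le_on : o <= n by lia.
have [P [kE|kE]] : exists P, k = 4 * P + 7 \/ k = 4 * P + 9.
  by exists ((k - 7) %/ 4); lia.
- apply: (factorial_le_NC (S := fun s => family3 n o h P (sg s))
    (K := fun i => 2 * i + 1) (X := fun i => (quad (3 * n + 1) n i 0).+1)) => //.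
  + by lia.
  + move=> s; rewrite kE.
    exact: (family3_difference_family P oh h_gt1 le_ho le_oh (sg_lt s) (sg_surj s)).
  + by move=> i lti; apply: quad_lt => //; lia.
  + move=> s i; rewrite kE /family3 ltn_ord.
    by apply: (odd_row3_closing P oh) => //; rewrite sgE ltn_ord.
  + move=> s i; rewrite kE /family3 ltn_ord sgE.
    exact: (odd_row3_quad P oh).
- apply: (factorial_le_NC (S := fun s => family1 n o h P (sg s))
    (K := fun i => 2 * i + 1) (X := fun i => (quad (3 * n + 3) n i 0).+1)) => //.
  + by lia.
  + move=> s; rewrite kE.
    exact: (family1_difference_family P oh h_gt1 le_ho le_oh (sg_lt s) (sg_surj s)).
  + by move=> i lti; apply: quad_lt => //; lia.
  + move=> s i; rewrite kE /family1 ltn_ord.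
    by apply: (odd_row1_closing P oh) => //; rewrite sgE ltn_ord.
  + move=> s i; rewrite kE /family1 ltn_ord sgE.
    exact: (odd_row1_quad P oh).
Qed.

(** Every factor beyond 32 in the factorial is at least 32. *)
Lemma exp_le_fact j : 32 ^ j <= (32 + j)`!.
Proof.
elim: j => [|j IH]; first by rewrite expn0 fact_gt0.
by rewrite expnS addnS factS leq_mul // leqW // leq_addr.
Qed.

Lemma exp4_le_uphalf_fact n : 576 <= n -> 3 * n * 4 ^ n <= (uphalf n)`!.
Proof.
move=> le_n; pose o := uphalf n; pose i := o - 288.
(* With o >= 288, 32^(o - 32) = 2^(o - 160) * 16^o, and 2^(o - 160) >= 6o >= 3n absorbs the linear
   factor. *)
have oE : o = 32 + (256 + i) by rewrite /i /o; lia.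
have le_no : n <= 2 * o by rewrite /o; lia.
apply: (@leq_trans (6 * o * 16 ^ o)).
  apply: leq_mul; first by lia.
  by rewrite -[16]/(4 ^ 2) -expnM leq_pexp2l.
rewrite -/o {2 3}oE; apply: leq_trans (exp_le_fact _).
have -> : 32 ^ (256 + i) = 2 ^ (128 + i) * 16 ^ (32 + (256 + i)).
  by rewrite -[32 in LHS]/(2 ^ 5) -[16]/(2 ^ 4) -!expnM -expnD; congr (_ ^ _); lia.
rewrite leq_mul2r; apply/orP; right.
have := ltn_expl i (ltnSn 1).
rewrite oE -[128]/(11 + 117) -addnA expnD -[2 ^ 11]/(2048) => lt_i.
have : 2 ^ i <= 2 ^ (117 + i) by rewrite leq_pexp2l // leq_addl.
by lia.
Qed.

Theorem proposition7 :
  exists N : nat, forall n k : nat, N <= n -> 1 < n -> 5 < k -> odd k ->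
    (n <> 4 %[mod 7] ->
       ((249%:R / 100%:R) ^+ n / k%:R <= (NC (2 * n * k + 1) k)%:R :> rat)%R) /\
    (n = 4 %[mod 7] ->
       ((335%:R / 100%:R) ^+ n / k%:R <= (NC (2 * n * k + 1) k)%:R :> rat)%R).
Proof.
exists 576 => n k le_n n_gt1 k_gt5 odd_k.
have le4 : 4 ^ n <= NC (2 * n * k + 1) k * k.
  have n3_gt0 : 0 < 3 * n by lia.
  rewrite -(leq_pmul2l n3_gt0).
  apply: leq_trans (exp4_le_uphalf_fact le_n) _.
  apply: leq_trans (uphalf_fact_le_NC _ k_gt5 odd_k) _; first by lia.
  (* What remains is v = 2nk + 1 <= 3nk. *)
  rewrite mulnCA leq_mul2l; apply/orP; right.
  have : 0 < n * k by rewrite muln_gt0; lia.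
  by lia.
have bound (x : rat) : (0 <= x <= 4%:R)%R ->
    (x ^+ n / k%:R <= (NC (2 * n * k + 1) k)%:R)%R.
  move=> /andP[x_ge0 x_le4].
  rewrite ler_pdivrMr ?ltr0n; last by lia.
  rewrite -natrM; apply: le_trans (_ : (4 ^ n)%:R <= _)%R; last by rewrite ler_nat.
  by rewrite natrX lerXn2r // nnegrE ler0n.
by split=> _; apply: bound.
Qed.
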